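(* Let $f,g\colon X\to Y$ be continuous maps, $R$ a commutative ring with unit, and $\mathcal{J}(f,g)\subset H^*(X;R)$ the image of $f^*-g^*\colon H^*(Y;R)\to H^*(X;R)$. Then $\mathrm{l.c.p.}\,\mathcal{J}(f,g)\leq \mathrm{D}(f,g)$.
   Context: $H^*(-;R)$ denotes (singular) cohomology with coefficients in $R$. For a subset $\mathcal{J}\subset H^*(X;R)$ (not necessarily a subring), $\mathrm{l.c.p.}\,\mathcal{J}$ is the least integer $k$ such that every cup product $u_0\smile\cdots\smile u_k$ of $k+1$ elements of $\mathcal{J}$ is zero in $H^*(X;R)$. For continuous maps $f,g\colon X\to Y$, the homotopic distance $\mathrm{D}(f,g)$ is the least integer $n\geq 0$ such that there is an open cover $\{U_0,\dots,U_n\}$ of $X$ with $f|_{U_j}\simeq g|_{U_j}$ for all $j$ ($\infty$ if none exists). *)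

(* Defs.v *)
From HB Require Import structures.
From mathcomp Require Import all_boot all_order all_algebra.
From mathcomp Require Import all_classical all_reals all_analysis.
From mathcomp Require Import Rstruct Rstruct_topology.

Import Order.TTheory GRing.Theory Num.Theory.
Local Open Scope classical_set_scope.
Local Open Scope ring_scope.

Notation RR := Rdefinitions.R.

Definition stdsimplex (n : nat) : set 'rV[RR]_n.+1 :=
  [set x | (forall i, 0 <= x 0 i) /\ \sum_(i < n.+1) x 0 i = 1].

(* A singular n-simplex in X is represented by a map R^{n+1} -> X that is
   continuous on the standard simplex (subspace topology); only its restriction
   to the simplex matters (see [cochain_wd]). *)
Definition singular {X : topologicalType} {n : nat} (s : 'rV[RR]_n.+1 -> X) :=
  {within (stdsimplex n), continuous s}.

Definition face_map {n : nat} (i : 'I_n.+2) (x : 'rV[RR]_n.+1) : 'rV[RR]_n.+2 :=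
  \row_j (match unlift i j with Some k => x 0 k | None => 0 end).

Definition front_map (n p : nat) (x : 'rV[RR]_p.+1) : 'rV[RR]_n.+1 :=
  \row_j (if (j <= p)%N then x 0 (inord j) else 0).
Definition back_map (n p : nat) (x : 'rV[RR]_(n - p).+1) : 'rV[RR]_n.+1 :=
  \row_j (if (p <= j)%N then x 0 (inord (j - p)) else 0).

Definition cochain (K : comPzRingType) (X : topologicalType) :=
  forall n : nat, ('rV[RR]_n.+1 -> X) -> K.

Section Cochains.
Context {K : comPzRingType}.

Definition cochain_wd {X : topologicalType} (c : cochain K X) :=
  forall n (s t : 'rV[RR]_n.+1 -> X), singular s -> singular t ->
    {in stdsimplex n, s =1 t} -> c n s = c n t.

(* finitely many nonzero degrees: an element of the direct sum of the C^n *)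
Definition cochain_fin {X : topologicalType} (c : cochain K X) :=
  exists N : nat, forall n s, (N < n)%N -> singular s -> c n s = 0.

Definition coboundary {X : topologicalType} (c : cochain K X) : cochain K X :=
  fun n => match n return ('rV[RR]_n.+1 -> X) -> K with
           | 0 => fun _ => 0
           | m.+1 => fun s =>
               \sum_(i < m.+2) (-1) ^+ i * c m (s \o face_map i)
           end.

Definition is_cocycle {X : topologicalType} (c : cochain K X) :=
  forall n s, singular s -> coboundary c n s = 0.

Definition is_coboundary {X : topologicalType} (c : cochain K X) :=
  exists w : cochain K X, cochain_wd w /\
    forall n s, singular s -> c n s = coboundary w n s.

Definition cup {X : topologicalType} (a b : cochain K X) : cochain K X :=
  fun n s => \sum_(p < n.+1) a p (s \o front_map n p) * b (n - p)%N (s \o back_map n p).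

Definition cup_unit {X : topologicalType} : cochain K X :=
  fun n _ => if n is 0 then 1 else 0.

Fixpoint cup_list {X : topologicalType} (l : seq (cochain K X)) : cochain K X :=
  if l is a :: l' then cup a (cup_list l') else cup_unit.

Definition cochain_sub {X : topologicalType} (a b : cochain K X) : cochain K X :=
  fun n s => a n s - b n s.

Definition pullback {X Y : topologicalType} (f : X -> Y) (c : cochain K Y) :
  cochain K X := fun n s => c n (f \o s).

(* A cocycle representing an element of H^*(Y;K) = (+)_n H^n(Y;K) *)
Definition cohom_rep {Y : topologicalType} (z : cochain K Y) :=
  [/\ cochain_wd z, cochain_fin z & is_cocycle z].

(* l.c.p. J(f,g) <= n : every cup product of n+1 elements of the image of
   f^* - g^* : H^*(Y;K) -> H^*(X;K) vanishes. *)
Definition lcp_image_le {X Y : topologicalType} (f g : X -> Y) (n : nat) :=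
  forall z : 'I_n.+1 -> cochain K Y, (forall i, cohom_rep (z i)) ->
    is_coboundary
      (cup_list [seq cochain_sub (pullback f (z i)) (pullback g (z i)) | i <- enum 'I_n.+1]).

End Cochains.
Arguments lcp_image_le K {X Y} f g n.

Definition homotopic_on {X Y : topologicalType} (U : set X) (f g : X -> Y) :=
  exists H : RR * X -> Y,
    [/\ {within `[0%R, 1%R] `*` U, continuous H},
        forall x, U x -> H (0%R, x) = f x
      & forall x, U x -> H (1%R, x) = g x].

Definition hdist_le {X Y : topologicalType} (f g : X -> Y) (n : nat) :=
  exists U : 'I_n.+1 -> set X,
    [/\ forall j, open (U j), \bigcup_j U j = setT
      & forall j, homotopic_on (U j) f g].

(* Main.v *)
Require Import Defs.
From HB Require Import structures.
From mathcomp Require Import all_boot all_order all_algebra.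
From mathcomp Require Import all_classical all_reals all_analysis.
From mathcomp Require Import Rstruct Rstruct_topology.
From mathcomp Require Import ring zify.

Set Implicit Arguments.
Unset Strict Implicit.
Unset Printing Implicit Defensive.
Import Order.TTheory GRing.Theory Num.Theory numFieldNormedType.Exports.
Local Open Scope classical_set_scope.
Local Open Scope ring_scope.

(** On each [U_j] of the cover, the prism operator of the homotopy from f to g
    makes [f^* z_j - g^* z_j] a coboundary, so it is cohomologous on X to a
    cocycle vanishing on all singular simplices contained in [U_j].  The product
    of these cocycles vanishes on every simplex contained in some [U_j].  A
    cocycle c with this property is a coboundary: if Sd is barycentric
    subdivision and T the chain homotopy with [dT + Td = id - Sd], then
    [c (T (Sd^k s))] vanishes for large k, so that
    [w s = \sum_k c (T (Sd^k s))] is a finite sum, and [dw = c] telescopes.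

    Affine simplices are represented by the lists of their vertices, and chain
    operators by their transposes, acting on functions of such lists.  The
    empty list is the (-1)-simplex of the augmented complex, which makes the
    recursions on lists uniform. *)

(** * Cochains on lists of vertices *)

Section ListCochains.
Variables (K : comPzRingType) (V : eqType).
Implicit Types (f g : seq V -> K) (l : seq V).

(** Transpose of the boundary in the form d(v.l) = l - v.(d l), where v.l is the cone on l from v.
    On a single vertex it returns [f [::]], the augmentation. *)
Fixpoint cobd f l : K :=
  if l is v :: l' then f l' - cobd (fun m => f (v :: m)) l' else 0.

Definition del (i : nat) l := take i l ++ drop i.+1 l.

Lemma cobd_sumE f l : cobd f l = \sum_(i < size l) (-1) ^+ i * f (del i l).
Proof.
elim: l f => [|v l IH] f /=; first by rewrite big_ord0.
rewrite big_ord_recl expr0 mul1r {1}/del /= drop0; congr (_ + _).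
rewrite IH -sumrN; apply: eq_bigr => i _.
by rewrite /bump add1n exprS mulN1r mulNr.
Qed.

(** The size condition lets operators whose fuel is the number of vertices be compared on faces. *)
Lemma cobd_ext f g l :
  (forall l', {subset l' <= l} -> size l = (size l').+1 -> f l' = g l') ->
  cobd f l = cobd g l.
Proof.
elim: l f g => //= v l IH f g H.
congr (_ - _); first by apply: H => // x xl; rewrite inE xl orbT.
apply: IH => l' sub sz; apply: H => [x|/=]; last by rewrite sz.
by rewrite !inE => /orP[->//|/sub ->]; rewrite orbT.
Qed.

Lemma cobdB f g l : cobd (fun m => f m - g m) l = cobd f l - cobd g l.
Proof.
elim: l f g => [|v l IH] f g /=; first by rewrite subr0.
by rewrite IH; ring.
Qed.

Lemma cobdN f l : cobd (fun m => - f m) l = - cobd f l.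
Proof.
elim: l f => [|v l IH] f /=; first by rewrite oppr0.
by rewrite IH; ring.
Qed.

Lemma cobdD f g l : cobd (fun m => f m + g m) l = cobd f l + cobd g l.
Proof.
elim: l f g => [|v l IH] f g /=; first by rewrite addr0.
by rewrite IH; ring.
Qed.

Lemma cobdZ (a : K) f l : cobd (fun m => a * f m) l = a * cobd f l.
Proof.
elim: l f => [|v l IH] f /=; first by rewrite mulr0.
by rewrite IH; ring.
Qed.

Lemma cobd_sum (I : Type) (r : seq I) (F : I -> seq V -> K) l :
  cobd (fun m => \sum_(i <- r) F i m) l = \sum_(i <- r) cobd (F i) l.
Proof.
elim: l F => [|v l IH] F /=; first by rewrite big1.
by rewrite sumrB IH.
Qed.

Lemma cobd_cobd f l : cobd (cobd f) l = 0.
Proof.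
elim: l f => //= v l IH f.
have -> : cobd (fun m => cobd f (v :: m)) l
  = cobd f l - cobd (cobd (fun m => f (v :: m))) l by exact: cobdB.
by rewrite IH subr0 subrr.
Qed.

(** * Alexander-Whitney products and the Leibniz rule *)

Fixpoint cup_seq f g l : K :=
  if l is v :: l' then f [:: v] * g l + cup_seq (fun m => f (v :: m)) g l' else 0.

Lemma cup_seq_sumE f g l :
  cup_seq f g l = \sum_(p < size l) f (take p.+1 l) * g (drop p l).
Proof.
elim: l f => [|v l IH] f /=; first by rewrite big_ord0.
by rewrite big_ord_recl /= take0 IH.
Qed.

Lemma cup_seq_ext f1 f2 g1 g2 l :
  (forall m, {subset m <= l} -> f1 m = f2 m) ->
  (forall m, {subset m <= l} -> g1 m = g2 m) -> cup_seq f1 g1 l = cup_seq f2 g2 l.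
Proof.
move=> Hf Hg; rewrite !cup_seq_sumE; apply: eq_bigr => p _.
by congr (_ * _); [apply: Hf => x /mem_take|apply: Hg => x /mem_drop].
Qed.

Lemma cup_seqBl f1 f2 g l :
  cup_seq (fun m => f1 m - f2 m) g l = cup_seq f1 g l - cup_seq f2 g l.
Proof. by rewrite !cup_seq_sumE -sumrB; apply: eq_bigr => p _; rewrite mulrBl. Qed.

Lemma cup_seqBr f g1 g2 l :
  cup_seq f (fun m => g1 m - g2 m) l = cup_seq f g1 l - cup_seq f g2 l.
Proof. by rewrite !cup_seq_sumE -sumrB; apply: eq_bigr => p _; rewrite mulrBr. Qed.

Lemma cup_seqNl f g l : cup_seq (fun m => - f m) g l = - cup_seq f g l.
Proof. by rewrite !cup_seq_sumE -sumrN; apply: eq_bigr => p _; rewrite mulNr. Qed.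

Lemma cup_seq0l f g l : (forall m, {subset m <= l} -> f m = 0) -> cup_seq f g l = 0.
Proof.
by move=> H; rewrite cup_seq_sumE big1// => p _; rewrite H ?mul0r// => x /mem_take.
Qed.

Lemma cup_seq0r f g l : (forall m, {subset m <= l} -> g m = 0) -> cup_seq f g l = 0.
Proof.
by move=> H; rewrite cup_seq_sumE big1// => p _; rewrite H ?mulr0// => x /mem_drop.
Qed.

(** A list of p+1 vertices has degree p, so this sign is the opposite of the usual (-1)^p; hence the
    minus sign in front of this term in the Leibniz rule. *)
Definition altl f l := (-1) ^+ size l * f l.

(* The last term is due to the augmentation. *)
Lemma cobd_cup_seq f g l : g [::] = 0 ->
  cobd (cup_seq f g) l = cup_seq (cobd f) g l - cup_seq (altl f) (cobd g) l - f [::] * g l.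
Proof.
move=> g0; elim: l f => [|v l IH] f /=; first by rewrite g0; ring.
rewrite cobdD cobdZ IH cup_seqBl {2}/altl /= expr1.
have -> : cup_seq (fun m => altl f (v :: m)) (cobd g) l =
  - cup_seq (altl (fun m => f (v :: m))) (cobd g) l; last by ring.
rewrite -cup_seqNl; apply: cup_seq_ext => // m _.
by rewrite /altl exprS; ring.
Qed.

Lemma cobd_altl f l : cobd (altl f) l = - altl (cobd f) l.
Proof.
case: l => [|v l]; first by rewrite /altl /= mulr0 oppr0.
rewrite /altl [size _]/= exprS mulN1r mulNr opprK -cobdZ.
by apply: cobd_ext => m _ [->].
Qed.

End ListCochains.

Lemma cobd_map (K : comPzRingType) (V W : eqType) (h : V -> W) (f : seq W -> K) l :
  cobd f (map h l) = cobd (f \o map h) l.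
Proof. by elim: l f => //= v l IH f; rewrite IH. Qed.

(** * The prism operator on lists *)

Section Prism.
Variables (K : comPzRingType) (V : eqType) (T : eqType) (t0 t1 : T).
Implicit Types (f : seq (T * V) -> K) (l : seq V).

(* [\sum_i (-1)^i f ((t0,v_0) .. (t0,v_i) (t1,v_i) .. (t1,v_n))], where
   [l = v_0 .. v_n] *)
Fixpoint prism f l : K :=
  if l is v :: l' then f ((t0, v) :: map (pair t1) l)
                       - prism (fun m => f ((t0, v) :: m)) l'
  else 0.

Lemma prism_ext f g l :
  (forall m, (forall p, p \in m -> (p.1 = t0 \/ p.1 = t1) /\ p.2 \in l) ->
     f m = g m) -> prism f l = prism g l.
Proof.
elim: l f g => //= v l IH f g H; congr (_ - _).
  apply: H => p; rewrite in_cons => /orP[/eqP->|].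
    by split; [left|exact: mem_head].
  by move=> /(@mapP _ _ _ (v :: l))[w wl ->]; split; [right|].
apply: IH => m sub; apply: H => p; rewrite in_cons => /orP[/eqP->|/sub[? pl]].
  by split; [left|exact: mem_head].
by split=> //; rewrite pl orbT.
Qed.

Lemma prismB f g l :
  prism (fun m => f m - g m) l = prism f l - prism g l.
Proof.
elim: l f g => [|v l IH] f g /=; first by rewrite subr0.
by rewrite IH; ring.
Qed.

Lemma prism0 l : prism (fun=> 0) l = 0.
Proof. by elim: l => //= v l ->; rewrite subr0. Qed.

(** After the first vertex v is split off, the two terms [prism f l] cancel, and so do those through
    both [(t0, v)] and [(t1, v)]. What remains is the same identity on the tail for f coned from
    [(t0, v)]. *)
Lemma prism_cobd f l :
  prism (cobd f) l + cobd (prism f) l = f (map (pair t1) l) - f (map (pair t0) l).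
Proof.
elim: l f => [|v l IH] f; first by rewrite /= subrr addr0.
rewrite /=.
have -> : prism (fun m => cobd f ((t0, v) :: m)) l
  = prism f l - prism (cobd (fun m => f ((t0, v) :: m))) l by exact: prismB.
rewrite (cobdB (fun m => f ((t0, v) :: (t1, v) :: map (pair t1) m))).
have /eqP := IH (fun m => f ((t0, v) :: m)).
rewrite eq_sym -subr_eq => /eqP <-.
by rewrite cobd_map /comp; ring.
Qed.

End Prism.

Lemma prism_map (K : comPzRingType) (V W T : eqType) (t0 t1 : T) (h : V -> W)
    (f : seq (T * W) -> K) l :
  prism t0 t1 f (map h l) =
  prism t0 t1 (fun m => f [seq (p.1, h p.2) | p <- m]) l.
Proof.
elim: l f => //= v l IH f; rewrite IH; congr (f (_ :: _ :: _) - _).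
by rewrite -!map_comp.
Qed.

(** * Barycentric subdivision *)

Section Affine.
Variable V : lmodType RR.
Implicit Types (l : seq V) (C : set V).

(** Missing vertices count as 0, so that [aff] commutes with linear maps without any condition on
    the length of l. *)
Definition aff {m} l (x : 'rV[RR]_m) : V := \sum_(i < m) x 0 i *: l`_i.

Definition convex_closed C := forall m l (x : 'rV[RR]_m.+1),
  stdsimplex m x -> (forall i, (i < m.+1)%N -> C l`_i) -> C (aff l x).

(** Impredicative form of the inclusion of l' in the convex hull of l. It is ready to be applied to
    the convex sets that matter here, standard simplices and closed balls. *)
Definition hull l l' := forall C, convex_closed C ->
  (forall v, v \in l -> C v) -> forall v, v \in l' -> C v.

Definition bary l : V := (size l)%:R^-1 *: \sum_(v <- l) v.

Lemma bary_in C v l : convex_closed C -> (forall u, u \in v :: l -> C u) ->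
  C (bary (v :: l)).
Proof.
move=> cC Cl; set m := size l.
have -> : bary (v :: l) = aff (v :: l) (const_mx m.+1%:R^-1 : 'rV[RR]_m.+1).
  rewrite /bary /aff (big_nth 0) big_mkord scaler_sumr /=.
  by apply: eq_bigr => i _; rewrite mxE.
apply: cC => [|i im]; last exact/Cl/mem_nth.
split=> [i|]; first by rewrite mxE invr_ge0 ler0n.
under eq_bigr do rewrite mxE.
by rewrite sumr_const card_ord -[_ *+ _]mulr_natr mulVf// pnatr_eq0.
Qed.

Lemma hull_sub l l' : {subset l' <= l} -> hull l l'.
Proof. by move=> sub C _ Cl v /sub/Cl. Qed.

Lemma hull_trans l l' l'' : hull l l' -> hull l' l'' -> hull l l''.
Proof. by move=> h h' C cC Cl; apply: h' => //; apply: h. Qed.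

Lemma hull_bary v l l' : hull (v :: l) l' -> hull (v :: l) (bary (v :: l) :: l').
Proof.
move=> h C cC Cl u; rewrite in_cons => /orP[/eqP->|]; first exact: bary_in.
exact: h.
Qed.

End Affine.

Section Subdivision.
Variables (K : comPzRingType) (V : lmodType RR).
Implicit Types (f g : seq V -> K) (l : seq V).

(* Transposes of [Sd l = b (Sd (d l))] and [T l = b (l - T (d l))], where b
   cones from the barycentre of l.  The argument n is fuel, equal to [size l]. *)
Fixpoint subdivn n f l : K :=
  if n is n'.+1 then cobd (subdivn n' (fun m => f (bary l :: m))) l else f [::].
Definition subdiv f l := subdivn (size l) f l.

Fixpoint subdiv_htpyn n f l : K :=
  if n is n'.+1 then f (bary l :: l) - cobd (subdiv_htpyn n' (fun m => f (bary l :: m))) l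
  else 0.
Definition subdiv_htpy f l := subdiv_htpyn (size l) f l.

Lemma subdiv_cons f v l :
  subdiv f (v :: l) = cobd (subdiv (fun m => f (bary (v :: l) :: m))) (v :: l).
Proof. by apply: cobd_ext => l' _ [sz]; rewrite /subdiv -sz. Qed.

Lemma subdiv_htpy_cons f v l : subdiv_htpy f (v :: l) = f (bary (v :: l) :: v :: l)
  - cobd (subdiv_htpy (fun m => f (bary (v :: l) :: m))) (v :: l).
Proof. by congr (_ - _); apply: cobd_ext => l' _ [sz]; rewrite /subdiv_htpy -sz. Qed.

Lemma subdivnB n f g l : subdivn n (fun m => f m - g m) l = subdivn n f l - subdivn n g l.
Proof.
elim: n f g l => //= n IH f g l.
by rewrite -cobdB; apply: cobd_ext => l' _ _; rewrite IH.
Qed.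

Lemma subdivB f g l : subdiv (fun m => f m - g m) l = subdiv f l - subdiv g l.
Proof. exact: subdivnB. Qed.

Lemma subdiv_htpynB n f g l : subdiv_htpyn n (fun m => f m - g m) l = subdiv_htpyn n f l - subdiv_htpyn n g l.
Proof.
elim: n f g l => [|n IH] f g l /=; first by rewrite subr0.
rewrite (cobd_ext (g := fun m => subdiv_htpyn n (fun m => f (bary l :: m)) m -
  subdiv_htpyn n (fun m => g (bary l :: m)) m)); last by move=> l' _ _; rewrite IH.
by rewrite cobdB; ring.
Qed.

Lemma subdiv_htpyB f g l : subdiv_htpy (fun m => f m - g m) l = subdiv_htpy f l - subdiv_htpy g l.
Proof. exact: subdiv_htpynB. Qed.

(** d(b(Sd d l)) = Sd d l - b(d Sd d l), and by induction on the faces d Sd d l = Sd d d l = 0. *)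
Lemma cobd_subdiv f l : cobd (subdiv f) l = subdiv (cobd f) l.
Proof.
have [n] := ubnP (size l); elim: n l f => // n IH [|v l] f // /ltnSE lt.
rewrite subdiv_cons; set b := bary _.
rewrite (cobd_ext (f := subdiv (fun m => cobd f (b :: m)))
  (g := fun m => subdiv f m - cobd (subdiv (fun m => f (b :: m))) m)); last first.
  move=> l' _ sz; rewrite IH; last by rewrite -sz.
  by rewrite -subdivB.
by rewrite cobdB cobd_cobd subr0.
Qed.

(** d(b(l - T d l)) = l - T d l - b(d l - d T d l). By induction on the faces d T d l = d l - Sd d
    l, so the last cone is b(Sd d l) = Sd l. *)
Lemma subdiv_htpy_cobd f l : subdiv_htpy (cobd f) l + cobd (subdiv_htpy f) l = f l - subdiv f l.
Proof.
have [n] := ubnP (size l); elim: n l f => [//|n IH] [|v l] f.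
  by rewrite /subdiv_htpy /subdiv /= addr0 subrr.
move=> /ltnSE lt; rewrite subdiv_cons subdiv_htpy_cons; set b := bary _.
set fb := fun m => f (b :: m).
rewrite (cobd_ext (f := subdiv_htpy (fun m => cobd f (b :: m)))
  (g := fun m => subdiv_htpy f m - (fb m - subdiv fb m - cobd (subdiv_htpy fb) m))); last first.
  move=> l' _ sz; rewrite -IH; last by rewrite -sz.
  by rewrite addrK -subdiv_htpyB.
rewrite cobdB (cobdB (fun m => fb m - subdiv fb m)) cobdB cobd_cobd.
have -> : cobd f (b :: v :: l) = f (v :: l) - cobd fb (v :: l) by [].
by ring.
Qed.

(** T only cones from barycentres of faces of l, which stay in the hull of l. *)
Lemma subdiv_htpy_ext f g l :
  (forall l', size l' = (size l).+1 -> hull l l' -> f l' = g l') ->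
  subdiv_htpy f l = subdiv_htpy g l.
Proof.
have [n] := ubnP (size l); elim: n l f g => [//|n IH] [|v l] f g.
  by [].
move=> /ltnSE lt H; rewrite !subdiv_htpy_cons; congr (_ - _).
  by apply: H => //; apply: hull_bary; apply: hull_sub.
apply: cobd_ext => l' sub sz; apply: IH => [|l'' sz' h]; first by rewrite -sz.
apply: H; first by rewrite /= sz' -sz.
by apply: hull_bary; apply: hull_trans h; apply: hull_sub.
Qed.

End Subdivision.
Arguments subdiv {K V} f l.
Arguments subdiv_htpy {K V} f l.

Lemma bary_map (V W : lmodType RR) (h : {linear V -> W}) l :
  bary (map h l) = h (bary l).
Proof. by rewrite /bary size_map big_map linearZ (linear_sum h). Qed.

Lemma subdiv_map (K : comPzRingType) (V W : lmodType RR) (h : {linear V -> W})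
  (f : seq W -> K) l : subdiv f (map h l) = subdiv (f \o map h) l.
Proof.
rewrite /subdiv size_map; move: (size l) => n; elim: n f l => //= n IH f l.
rewrite cobd_map; apply: cobd_ext => l' _ _ /=; rewrite IH bary_map.
by [].
Qed.

Lemma subdiv_htpy_map (K : comPzRingType) (V W : lmodType RR) (h : {linear V -> W})
  (f : seq W -> K) l : subdiv_htpy f (map h l) = subdiv_htpy (f \o map h) l.
Proof.
rewrite /subdiv_htpy size_map; move: (size l) => n; elim: n f l => //= n IH f l.
rewrite cobd_map bary_map; congr (_ - _).
by apply: cobd_ext => l' _ _ /=; rewrite IH.
Qed.

Lemma iter_subdiv_map (K : comPzRingType) (V W : lmodType RR) (h : {linear V -> W})
  (f : seq W -> K) k l :
  iter k subdiv f (map h l) = iter k subdiv (f \o map h) l.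
Proof.
elim: k l => //= k IH l; rewrite subdiv_map; congr subdiv.
by apply/funext => m; rewrite /= IH.
Qed.

Lemma cobd_iter_subdiv (K : comPzRingType) (V : lmodType RR) (f : seq V -> K) k l :
  cobd (iter k subdiv f) l = iter k subdiv (cobd f) l.
Proof.
elim: k l => //= k IH l; rewrite cobd_subdiv; congr subdiv.
by apply/funext => m.
Qed.

Lemma iter_subdivB (K : comPzRingType) (V : lmodType RR) (f g : seq V -> K) k l :
  iter k subdiv (fun m => f m - g m) l = iter k subdiv f l - iter k subdiv g l.
Proof.
elim: k l => //= k IH l; rewrite -subdivB; congr subdiv.
by apply/funext => m.
Qed.

(** * Mesh of iterated barycentric subdivisions *)

Section Mesh.
Variables (K : comPzRingType) (V : normedModType RR).
Implicit Types (f g : seq V -> K) (l : seq V).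

Lemma ball_convex_closed (a : V) (r : RR) :
  convex_closed [set v | `|v - a| <= r].
Proof.
move=> m l x [x0 x1] Cl /=.
have -> : aff l x - a = \sum_(i < m.+1) x 0 i *: (l`_i - a).
  under eq_bigr do rewrite scalerBr.
  by rewrite sumrB -scaler_suml x1 scale1r.
apply: (le_trans (ler_norm_sum _ _ _)).
rewrite -[leRHS]mul1r -x1 mulr_suml; apply: ler_sum => i _.
by rewrite normrZ ger0_norm// ler_wpM2l//; apply: Cl.
Qed.

Definition diam_le l (d : RR) := forall u v, u \in l -> v \in l -> `|u - v| <= d.

(** This is N/(N+1), the classical contraction factor of the mesh in dimension N. *)
Definition rate (N : nat) : RR := 1 - N.+1%:R^-1.

Lemma rate_ge0 N : 0 <= rate N.
Proof. by rewrite subr_ge0 invf_le1 ?ler1n// ltr0n. Qed.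

Lemma rate_lt1 N : rate N < 1.
Proof. by rewrite ltrBlDr ltrDl invr_gt0 ltr0n. Qed.

(** With s vertices, v minus the barycentre is the mean of the differences v - u. The term u = v
    vanishes, which leaves at most (s-1)/s times d. *)
Lemma bary_dist N l d v : (size l <= N.+1)%N -> diam_le l d -> v \in l ->
  `|v - bary l| <= rate N * d.
Proof.
move=> lN diam_l vl.
have s0 : (size l)%:R != 0 :> RR by rewrite pnatr_eq0; case: (l) vl.
have d0 : 0 <= d by apply: le_trans (diam_l _ _ vl vl).
have -> : v - bary l = (size l)%:R^-1 *: \sum_(u <- l) (v - u).
  rewrite sumrB scalerBr big_const_seq count_predT iter_addr_0.
  by rewrite -scaler_nat scalerA mulVf// scale1r.
rewrite normrZ ger0_norm ?invr_ge0//.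
rewrite -(ler_pM2l (x := (size l)%:R)) ?lt_def ?s0//= mulrA divff// mul1r.
apply: (le_trans (ler_norm_sum _ _ _)).
have -> : \sum_(i <- l) `|v - i| = \sum_(i <- rem v l) `|v - i|.
  by rewrite (perm_big _ (perm_to_rem vl)) big_cons subrr normr0 /= add0r.
apply: (@le_trans _ _ (\sum_(i <- rem v l) d)).
  rewrite big_seq [leRHS]big_seq; apply: ler_sum => i /mem_rem il.
  exact: diam_l.
rewrite big_const_seq count_predT iter_addr_0 size_rem// mulrA -[leLHS]mulr_natl.
apply: ler_wpM2r => //.
have l0 : (0 < size l)%N by case: (l) vl.
rewrite -subn1 natrB// /rate mulrBr mulr1 lerB// -ler_pdivlMr ?invr_gt0 ?ltr0n//.
by rewrite mul1r invrK ler_nat.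
Qed.

(** The mesh estimate takes the form of an extensionality principle because the simplices of Sd l
    are never listed. Two vertices of such a simplex either lie in the subdivision of a face, or one
    of them is the barycentre. A fixed N above the dimension gives all faces the same factor. *)
Lemma subdiv_ext N f g l : (size l <= N.+1)%N ->
  (forall l', size l' = size l -> hull l l' ->
     (forall d, diam_le l d -> diam_le l' (rate N * d)) -> f l' = g l') ->
  subdiv f l = subdiv g l.
Proof.
have [n] := ubnP (size l); elim: n l f g => [//|n IH] [|v l] f g.
  by move=> _ _ H; apply: H => // d _ u.
move=> /ltnSE lt lN H; rewrite !subdiv_cons; set b := bary _.
apply: cobd_ext => l' sub sz.
apply: IH => [||l'' sz' h dd]; [by rewrite -sz|by rewrite ltnW// -sz|].
have hb : hull (v :: l) (b :: l'') by apply: hull_bary; apply: hull_trans h; apply: hull_sub.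
apply: H => [|//|d Hd]; first by rewrite /= sz' -sz.
have d0 : 0 <= rate N * d.
  rewrite mulr_ge0 ?rate_ge0//.
  exact: le_trans (normr_ge0 _) (Hd _ _ (mem_head _ _) (mem_head _ _)).
(* The closed ball around b is convex and contains the vertices of [v :: l], hence their whole
   hull. *)
have near_b u : u \in b :: l'' -> `|u - b| <= rate N * d.
  apply: (hb _ (@ball_convex_closed b (rate N * d))) => w wl.
  exact: bary_dist.
move=> u w; rewrite in_cons => /orP[/eqP->|ul] wl.
  by rewrite distrC near_b.
move: wl; rewrite in_cons => /orP[/eqP->|wl].
  by rewrite near_b// in_cons ul orbT.
by apply: dd => // u' w' /sub ? /sub; apply: Hd.
Qed.

Lemma iter_subdiv_ext N k f g l : (size l <= N.+1)%N ->
  (forall l', size l' = size l -> hull l l' ->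
     (forall d, diam_le l d -> diam_le l' (rate N ^+ k * d)) -> f l' = g l') ->
  iter k subdiv f l = iter k subdiv g l.
Proof.
elim: k l => [|k IH] l lN H.
  by apply: H => [//||d]; [exact: hull_sub|rewrite expr0 mul1r].
apply: (subdiv_ext lN) => l' sz h dd; apply: IH => [|l'' sz' h' dd']; first by rewrite sz.
apply: H; [by rewrite sz'|exact: hull_trans h h'|move=> d Hd].
by rewrite exprSr -mulrA; apply/dd'/dd.
Qed.

End Mesh.

(** * Singular cochains on affine simplices *)

Section Evaluation.
Context {K : comPzRingType} {X : topologicalType}.
Implicit Types (a b c w : cochain K X).

(* The value of c on the affine simplex with vertices l in V, mapped by s. *)
Definition ev {V : lmodType RR} c (s : V -> X) (l : seq V) : K :=
  if l is v :: l' then c (size l') (s \o (aff l : 'rV[RR]_(size l').+1 -> V))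
  else 0.

Lemma evE (V : lmodType RR) c (s : V -> X) l n : size l = n.+1 ->
  ev c s l = c n (s \o aff l).
Proof. by case: l => //= v l [<-]. Qed.


Lemma aff_map (V W : lmodType RR) (h : {linear V -> W}) m l (x : 'rV[RR]_m) :
  aff (map h l) x = h (aff l x).
Proof.
rewrite /aff linear_sum; apply: eq_bigr => i _; rewrite linearZ /=; congr (_ *: _).
have [il|il] := ltnP i (size l); first by rewrite (nth_map 0).
by rewrite !nth_default ?size_map// linear0.
Qed.

Lemma ev_map (V W : lmodType RR) (h : {linear V -> W}) c (s : W -> X) l :
  ev c s (map h l) = ev c (s \o h) l.
Proof.
case: l => // v l; rewrite (@evE _ _ _ _ (size l)) ?size_map// (@evE _ _ _ _ (size l))//.
by congr (c _ _); apply/funext => x; rewrite /= -aff_map.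
Qed.

Lemma size_del (V : eqType) i (l : seq V) : (i < size l)%N ->
  size l = (size (del i l)).+1.
Proof. by move=> il; rewrite /del size_cat size_take size_drop il; lia. Qed.

Lemma nth_del (V : eqType) (x0 : V) i (l : seq V) j : (i < size l)%N ->
  nth x0 (del i l) j = nth x0 l (bump i j).
Proof.
move=> il; rewrite /del nth_cat size_take il /bump.
have [ji|ij] := ltnP j i; first by rewrite nth_take.
by rewrite nth_drop; congr nth; lia.
Qed.

Lemma aff_face (V : lmodType RR) n (l : seq V) (i : 'I_n.+2) x :
  (i < size l)%N -> aff l (face_map i x) = aff (del i l) x.
Proof.
move=> il; rewrite /aff (bigD1_ord i)//= mxE unlift_none scale0r add0r.
by apply: eq_bigr => j _; rewrite mxE liftK nth_del.
Qed.

Lemma cobd_ev (V : lmodType RR) c (s : V -> X) l :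
  cobd (ev c s) l = ev (coboundary c) s l.
Proof.
(* On a single vertex the augmentation contributes nothing, since [ev] is 0 on the empty list. *)
case: l => [//|v [|u l]]; first by rewrite /= subrr.
rewrite (@evE _ _ _ _ ((size l).+1))// cobd_sumE; apply: eq_bigr => i _; congr (_ * _).
rewrite (@evE _ _ _ _ (size l)); last first.
  by apply: succn_inj; rewrite -size_del.
by congr (c _ _); apply/funext => x; rewrite /= aff_face.
Qed.

Lemma aff_front (V : lmodType RR) (l : seq V) n p x : (p <= n)%N ->
  aff l (front_map n p x) = aff (take p.+1 l) x.
Proof.
move=> pn; rewrite /aff.
pose F i := x 0 (inord i) *: (take p.+1 l)`_i.
transitivity (\sum_(i < p.+1) F i); last first.
  by apply: eq_bigr => i _; rewrite /F inord_val.
rewrite (big_ord_widen n.+1 F)// [RHS]big_mkcond /=.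
apply: eq_bigr => j _; rewrite mxE ltnS /F.
by case: ifP => jp; rewrite ?scale0r// nth_take.
Qed.

Lemma aff_back (V : lmodType RR) (l : seq V) n p x : (p <= n)%N ->
  aff l (back_map n p x) = aff (drop p l) x.
Proof.
move=> pn; rewrite /aff.
pose F i := x 0 (inord i) *: (drop p l)`_i.
transitivity (\sum_(i < (n - p).+1) F i); last first.
  by apply: eq_bigr => i _; rewrite /F inord_val.
pose G j := (if (p <= j)%N then x 0 (inord (j - p)) else 0) *: l`_j.
transitivity (\sum_(j < n.+1) G j); first by apply: eq_bigr => j _; rewrite mxE.
rewrite -(big_mkord xpredT G) (big_cat_nat _ (n := p))//=; last exact: leqW.
rewrite big_nat big1 ?add0r => [|j /andP[_ jp]]; last first.
  by rewrite /G leqNgt jp scale0r.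
rewrite -{1}[p]add0n big_addn subSn// big_mkord.
apply: eq_bigr => j _.
by rewrite /G /F leq_addl addnK nth_drop addnC.
Qed.

Lemma ev_cup (V : lmodType RR) a b (s : V -> X) l :
  ev (cup a b) s l = cup_seq (ev a s) (ev b s) l.
Proof.
case: l => // v l; rewrite (@evE _ _ _ _ (size l))// cup_seq_sumE.
apply: eq_bigr => p _; have pl : (p <= size l)%N by rewrite -ltnS.
rewrite (@evE _ _ _ _ p) ?size_takel//.
rewrite (@evE _ _ _ _ (size l - p)) ?size_drop ?subSn//.
congr (_ * _); [congr (a p _)|congr (b (size l - p)%N _)]; apply/funext => x /=.
  by rewrite aff_front.
by rewrite aff_back.
Qed.

Definition alt a : cochain K X := fun n s => (-1) ^+ n.+1 * a n s.

Lemma ev_alt (V : lmodType RR) a (s : V -> X) : ev (alt a) s = altl (ev a s).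
Proof. by apply/funext => -[|v l]; rewrite /altl /= ?mulr0. Qed.

End Evaluation.

(** * The standard simplex and its vertices *)

Definition verts n : seq 'rV[RR]_n.+1 :=
  mkseq (fun j => \row_(k < n.+1) (k == j :> nat)%:R) n.+1.

Arguments verts : simpl never.

Lemma size_verts n : size (verts n) = n.+1.
Proof. exact: size_mkseq. Qed.

Lemma aff_verts n x : aff (verts n) x = x.
Proof.
apply/rowP => k; rewrite /aff summxE (bigD1 k)//= nth_mkseq// !mxE eqxx mulr1.
rewrite big1 ?addr0// => j jk; rewrite nth_mkseq// !mxE.
by rewrite (_ : (k == j :> nat) = false) ?mulr0// eq_sym; apply/negbTE.
Qed.

(** The affine simplex on the standard vertices is the identity; this carries identities between
    functions of lists over to arbitrary singular simplices. *)
Lemma ev_verts (K : comPzRingType) (X : topologicalType) (c : cochain K X) n s :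
  ev c s (verts n) = c n s.
Proof.
rewrite (@evE _ _ _ _ _ _ n) ?size_verts//.
by congr (c _ _); apply/funext => x; rewrite /= aff_verts.
Qed.

Lemma face_map_linear n (i : 'I_n.+2) : linear (face_map i).
Proof.
move=> a x y; apply/rowP => j; rewrite !mxE.
by case: unlift => [k|]; rewrite ?mxE// mulr0 addr0.
Qed.

HB.instance Definition _ n (i : 'I_n.+2) :=
  GRing.isLinear.Build RR 'rV[RR]_n.+1 'rV[RR]_n.+2 _ (face_map i)
    (face_map_linear i).

Lemma del_verts n (i : 'I_n.+2) : del i (verts n.+1) = map (face_map i) (verts n).
Proof.
have iv : (i < size (verts n.+1))%N by rewrite size_verts.
have sz : size (del i (verts n.+1)) = n.+1.
  by apply: succn_inj; rewrite -size_del ?size_verts.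
apply: (@eq_from_nth _ 0) => [|j]; first by rewrite size_map size_verts.
rewrite sz => jn; rewrite nth_del// [RHS](nth_map 0) ?size_verts//.
rewrite !nth_mkseq//; last by rewrite /bump; case: leqP; lia.
apply/rowP => k; rewrite !mxE.
case: unliftP => [k'|] ->; first by rewrite mxE /= (inj_eq (can_inj (bumpK i))).
by rewrite (negbTE (neq_bump _ _)).
Qed.

(** Serves cochains built from chain operators: their value on a face of s is computed by a function
    f of lists in the ambient simplex. *)
Lemma coboundary_verts (K : comPzRingType) (X : topologicalType)
    (w : cochain K X) n (s : 'rV[RR]_n.+2 -> X) (f : seq 'rV[RR]_n.+2 -> K) :
  (forall i, w n (s \o face_map i) = f (map (face_map i) (verts n))) ->
  coboundary w n.+1 s = cobd f (verts n.+1).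
Proof.
move=> wf; rewrite cobd_sumE size_verts; apply: eq_bigr => i _.
by rewrite wf del_verts.
Qed.

Lemma stdsimplex_convex n : convex_closed (stdsimplex n).
Proof.
move=> m l x [x0 x1] Cl; split=> [k|].
  rewrite summxE sumr_ge0// => i _; rewrite mxE mulr_ge0//.
  by have [] := Cl i (ltn_ord i).
under eq_bigr do rewrite summxE.
rewrite exchange_big /= -[RHS]x1; apply: eq_bigr => i _.
under eq_bigr do rewrite mxE.
by rewrite -mulr_sumr; have [_ ->] := Cl i (ltn_ord i); rewrite mulr1.
Qed.

Lemma verts_stdsimplex n v : v \in verts n -> stdsimplex n v.
Proof.
move=> /mapP[j]; rewrite mem_iota add0n => /= jn ->.
split=> [k|]; first by rewrite mxE ler0n.
rewrite (bigD1 (Ordinal jn))//= mxE eqxx big1 ?addr0// => k kj.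
by rewrite mxE (_ : (k == j :> nat) = false)//; apply/negbTE.
Qed.

Lemma aff_in (V : lmodType RR) (C : set V) n l x : convex_closed C ->
  (forall v, v \in l -> C v) -> size l = n.+1 -> stdsimplex n x -> C (aff l x).
Proof. by move=> cC Cl sl dx; apply: cC => // i il; apply/Cl/mem_nth; rewrite sl. Qed.

Lemma face_stdsimplex n (i : 'I_n.+2) x :
  stdsimplex n x -> stdsimplex n.+1 (face_map i x).
Proof.
move=> dx; rewrite -[face_map i x]aff_verts aff_face ?size_verts// del_verts.
apply: aff_in dx; [exact: stdsimplex_convex| |by rewrite size_map size_verts].
rewrite -del_verts => v vd; apply: verts_stdsimplex.
by move: vd; rewrite /del mem_cat => /orP[/mem_take|/mem_drop].
Qed.

Lemma within_comp (T U W : topologicalType) (A : set T) (B : set U)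
    (f : T -> U) (h : U -> W) :
  {within A, continuous f} -> {within B, continuous h} ->
  (forall x, A x -> B (f x)) -> {within A, continuous (h \o f)}.
Proof.
move=> /subspace_continuousP cf /subspace_continuousP ch AB.
apply/subspace_continuousP => x Ax.
apply: cvg_comp (ch _ (AB _ Ax)) => P BP.
have H : nbhs x [set z | A z -> B (f z) -> P (f z)] by apply: cf BP.
rewrite /= !nbhs_simpl /within /=.
by apply: filterS H => z H Az; apply: H => //; apply: AB.
Qed.

Lemma aff_continuous (V : normedModType RR) m l :
  continuous (aff l : 'rV[RR]_m.+1 -> V).
Proof.
rewrite /aff; elim: (index_enum _) => [|i r IH].
  rewrite (_ : (fun x => _) = cst 0); first exact: cst_continuous.
  by apply/funext => x; rewrite big_nil.
rewrite (_ : (fun x => _) = (fun x : 'rV[RR]_m.+1 => x 0 i *: l`_i) +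
  (fun x : 'rV[RR]_m.+1 => \sum_(j <- r) x 0 j *: l`_j)); last first.
  by apply/funext => x; rewrite big_cons.
move=> x; apply: continuousD; last exact: IH.
by apply: continuousZr_tmp; apply: coord_continuous.
Qed.

Section Singular.
Variables (V : normedModType RR) (X : topologicalType) (C : set V) (s : V -> X).
Hypotheses (cC : convex_closed C) (cs : {within C, continuous s}).

Lemma singular_aff l m : size l = m.+1 -> (forall v, v \in l -> C v) ->
  singular (s \o aff l : 'rV[RR]_m.+1 -> X).
Proof.
move=> sl Cl; apply: within_comp cs _.
  exact/continuous_subspaceT/aff_continuous.
by move=> x; apply: aff_in.
Qed.

Variables (K : comPzRingType) (c : cochain K X).

Lemma ev_wd (t : V -> X) l : cochain_wd c -> {within C, continuous t} ->
  (forall x, C x -> s x = t x) -> (forall v, v \in l -> C v) ->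
  ev c s l = ev c t l.
Proof.
move=> cwd ct st Cl; case E: l => [//|v m].
have sl : size l = (size m).+1 by rewrite E.
rewrite -E !(@evE _ _ _ _ _ _ (size m))//; apply: cwd.
- exact: singular_aff.
- apply: within_comp ct _; first exact/continuous_subspaceT/aff_continuous.
  by move=> x; apply: aff_in.
- by move=> x /set_mem dx /=; apply: st; apply: aff_in dx.
Qed.

Lemma cobd_ev_cocycle l : is_cocycle c -> (forall v, v \in l -> C v) ->
  cobd (ev c s) l = 0.
Proof.
move=> cc Cl; rewrite cobd_ev; case E: l => [//|v m].
have sl : size l = (size m).+1 by rewrite E.
by rewrite -E (@evE _ _ _ _ _ _ (size m))//; apply: cc; apply: singular_aff.
Qed.

End Singular.

Lemma singular_face (X : topologicalType) n (s : 'rV[RR]_n.+2 -> X) i :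
  singular s -> singular (s \o face_map i).
Proof.
move=> hs; have -> : s \o face_map i = s \o aff (map (face_map i) (verts n)).
  by apply/funext => x; rewrite /comp aff_map aff_verts.
apply: (singular_aff (@stdsimplex_convex _) hs); first by rewrite size_map size_verts.
move=> v /mapP[u /verts_stdsimplex du ->]; exact: face_stdsimplex.
Qed.

(** * Cocycles vanishing on small simplices *)

Lemma iter_subdiv0 (K : comPzRingType) (V : lmodType RR) k (l : seq V) :
  iter k subdiv (fun=> 0 : K) l = 0.
Proof.
have := iter_subdivB (fun=> 0 : K) (fun=> 0) k l.
by rewrite !subrr.
Qed.

Lemma subdiv_htpy0 (K : comPzRingType) (V : lmodType RR) (l : seq V) :
  subdiv_htpy (fun=> 0 : K) l = 0.
Proof.
have := subdiv_htpyB (fun=> 0 : K) (fun=> 0) l.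
by rewrite !subrr.
Qed.

Lemma stdsimplex_norm n x : stdsimplex n x -> `|x| <= 1.
Proof.
move=> [x0 x1]; rewrite /Num.norm /= mx_normrE; apply: bigmax_le => // -[i j] _ /=.
rewrite ord1 ger0_norm// -x1 (bigD1 j)//= lerDl.
by apply: sumr_ge0.
Qed.

Lemma stdsimplex_compact n : compact (stdsimplex n).
Proof.
apply: bounded_closed_compact.
  exists 1; split=> // M M1 x /stdsimplex_norm/le_trans; apply; exact: ltW.
(* The coordinate sum is written as an affine map to get its continuity from [aff_continuous]. *)
pose sum_coord := aff (nseq n.+1 (1 : RR^o)) : 'rV[RR]_n.+1 -> RR^o.
have sumE x : sum_coord x = \sum_(i < n.+1) x 0 i.
  apply: eq_bigr => i _; rewrite nth_nseq ltn_ord.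
  by rewrite /GRing.scale /= mulr1.
have -> : stdsimplex n =
    \bigcap_i ((fun x : 'rV[RR]_n.+1 => x 0 i) @^-1` [set y | 0 <= y])
    `&` sum_coord @^-1` [set 1].
  apply/seteqP; split=> x [x0]; rewrite /= ?sumE => x1; split=> // i.
    by move=> _; apply: x0.
  by apply: x0.
apply: closedI.
  apply: closed_bigI => i _; apply: closed_comp => [x _|]; last exact: closed_ge.
  exact: coord_continuous.
apply: closed_comp => [x _|]; last exact: closed_eq.
exact: aff_continuous.
Qed.

Section Small.
Variables (K : comPzRingType) (X : topologicalType) (I : Type) (U : I -> set X).
Hypotheses (Uo : forall j, open (U j)) (Ucov : forall x, exists j, U j x).

Definition small n (s : 'rV[RR]_n.+1 -> X) :=
  exists j, forall x, stdsimplex n x -> U j (s x).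

(** Around each x some e works for all nearby centres, by halving the radius of a ball mapped into
    one [U j]. Compactness in its near-covering form makes e uniform. *)
Lemma lebesgue_number n (s : 'rV[RR]_n.+1 -> X) : singular s ->
  exists2 e : RR, 0 < e & forall x, stdsimplex n x -> exists j,
    forall y, stdsimplex n y -> `|y - x| <= e -> U j (s y).
Proof.
move=> /subspace_continuousP hs.
pose P (e : RR) x := stdsimplex n x -> exists j,
  forall y, stdsimplex n y -> `|y - x| <= e -> U j (s y).
have /compact_near_coveringP cpt := @stdsimplex_compact n.
have : \forall e \near 0^'+, stdsimplex n `<=` P e.
  apply: cpt => x dx; have [j Uj] := Ucov (s x).
  have /nbhs_ballP[d /= d0 Hd] : nbhs x [set y | stdsimplex n y -> U j (s y)].
    by apply: (hs x dx); apply: open_nbhs_nbhs.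
  have d20 : 0 < d / 2 by rewrite divr_gt0.
  near=> z e => dz; exists j => y dy /= ye; apply: Hd => //.
  have xz : `|x - z| < d / 2.
    by near: z; have := nbhsx_ballx x _ d20; rewrite -ball_normE; exact.
  have ed : e < d / 2 by near: e; exact: nbhs_right_lt.
  rewrite -ball_normE /= (splitr d) (le_lt_trans (ler_distD z _ _))//.
  by rewrite ltrD// distrC (le_lt_trans ye).
move=> H; near (0 : RR)^'+ => e; exists e; first by near: e; exact: nbhs_right_gt.
move=> x dx.
have He : stdsimplex n `<=` P e by near: e.
exact: He.
Unshelve. all: by end_near.
Qed.

Variable c : cochain K X.
Hypotheses (cwd : cochain_wd c) (cc : is_cocycle c)
  (c_small : forall n (s : 'rV[RR]_n.+1 -> X), singular s -> small s -> c s = 0).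

(** For large k the simplices of Sd^k have diameter below a Lebesgue number, so each lies over one
    [U j]. The bound on k is uniform in f, which is later both [ev c s] and its image under
    [subdiv_htpy]; the hypothesis speaks of the hull of l since T leads to other simplices there. *)
Lemma iter_subdiv_small n (s : 'rV[RR]_n.+1 -> X) : singular s ->
  \forall k \near \oo, forall f : seq 'rV[RR]_n.+1 -> K,
    (forall l, (forall l', hull l l' -> ev c s l' = 0) -> f l = 0) ->
    iter k subdiv f (verts n) = 0.
Proof.
move=> hs; have [e e0 He] := lebesgue_number hs.
have : \forall k \near \oo, rate n ^+ k * 2 <= e.
  have r1 : `|rate n| < 1 by rewrite ger0_norm ?rate_ge0 ?rate_lt1.
  have := cvg_geometric (2 : RR) r1 => /cvgr0_norm_le /(_ _ e0).
  apply: filterS => k /=; rewrite /geometric /= mulrC.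
  exact: le_trans (ler_norm _).
apply: filterS => k ke f f0; rewrite -(@iter_subdiv0 K _ k (verts n)).
apply: (@iter_subdiv_ext _ _ n) => [|l sl hl diam_l]; first by rewrite size_verts.
have diam_l2 : diam_le (verts n) 2.
  move=> u v /verts_stdsimplex du /verts_stdsimplex dv.
  rewrite (le_trans (ler_normB _ _))// (_ : 2 = 1 + 1)// lerD//;
  exact: stdsimplex_norm.
have ld v : v \in l -> stdsimplex n v.
  by apply: hl; [exact: stdsimplex_convex|exact: verts_stdsimplex].
have {}diam_l u v : u \in l -> v \in l -> `|u - v| <= e.
  by move=> ul vl; apply: le_trans ke; apply: diam_l.
(* Any vertex of l will do as the centre of a ball of radius e that contains l, hence also every
   simplex in its hull. *)
have [x0 x0l] : exists x0, x0 \in l.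
  by case: l sl {hl ld diam_l} => [|x0 l _]; [rewrite size_verts|exists x0; exact: mem_head].
apply: f0 => l' hl'; have l'd := hl' _ (@stdsimplex_convex n) ld.
case E : l' => [//|v m].
have sl' : size l' = (size m).+1 by rewrite E.
rewrite -E (@evE _ _ _ _ _ _ (size m))//.
apply: c_small; first exact: (singular_aff (@stdsimplex_convex n) hs).
have [j Hj] := He _ (ld _ x0l); exists j => x dx /=; apply: Hj.
  by apply: aff_in dx => //; exact: stdsimplex_convex.
apply: (aff_in (C := [set v | `|v - x0| <= e])) dx => //.
  exact: ball_convex_closed.
by apply: hl'; [exact: ball_convex_closed|move=> u ul; apply: diam_l].
Qed.

(* [\sum_k c (T (Sd^k s))] is eventually constant since [T (Sd^k s)] consists of
   small simplices for large k. *)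
Let homotopy_sum n (s : 'rV[RR]_n.+1 -> X) M :=
  \sum_(k < M) iter k subdiv (subdiv_htpy (ev c s)) (verts n).

(** A cochain must be given on all maps s; the default 0 covers those whose sums do not stabilise,
    which can occur only for non-singular s. *)
Let homotopy_limit : cochain K X := fun n s =>
  xget 0 [set v | \forall M \near \oo, homotopy_sum s M = v].

Let homotopy_limitP n (s : 'rV[RR]_n.+1 -> X) : singular s ->
  \forall M \near \oo, homotopy_sum s M = homotopy_limit s.
Proof.
move=> hs; rewrite /homotopy_limit.
suff : exists v, \forall M \near \oo, homotopy_sum s M = v by exact: xgetPex.
have [k0 _ Hk] := iter_subdiv_small hs; exists (homotopy_sum s k0).
exists k0 => // M /= /subnKC <-; elim: (M - k0)%N => [|j IH]; first by rewrite addn0.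
rewrite addnS /homotopy_sum big_ord_recr /= -/(homotopy_sum _ _) IH.
rewrite Hk ?addr0//= ?leq_addr// => l hl.
by rewrite -(subdiv_htpy0 K l); apply: subdiv_htpy_ext => l' _; apply: hl.
Qed.

Lemma small_coboundary : is_coboundary c.
Proof.
exists homotopy_limit; split=> [n s t hs ht st|n s hs].
  (* The sums for s and t agree for every M, so they have the same eventual values. *)
  congr xget; apply/seteqP.
  have E M : homotopy_sum s M = homotopy_sum t M.
    apply: eq_bigr => k _; apply: (@iter_subdiv_ext _ _ n) => [|l _ hl _].
      by rewrite size_verts.
    apply: subdiv_htpy_ext => l' _ hl'; apply: (ev_wd (@stdsimplex_convex n) hs) => //.
      by move=> x dx; apply: st; rewrite inE.
    apply: hl'; first exact: stdsimplex_convex.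
    by apply: hl; [exact: stdsimplex_convex|exact: verts_stdsimplex].
  by split=> v; apply: filterS => M <-.
pose h M l := \sum_(k < M) iter k subdiv (subdiv_htpy (ev c s)) l.
have tele M : cobd (h M) (verts n) = c s - iter M subdiv (ev c s) (verts n).
  pose A k := iter k subdiv (ev c s) (verts n).
  pose F k := cobd (iter k subdiv (subdiv_htpy (ev c s))) (verts n).
  have FE k : F k = A k - A k.+1.
    rewrite /F cobd_iter_subdiv.
    have -> : iter k subdiv (cobd (subdiv_htpy (ev c s))) (verts n) =
        iter k subdiv (fun l => ev c s l - subdiv (ev c s) l) (verts n).
      apply: (@iter_subdiv_ext _ _ n) => [|l _ hl _]; first by rewrite size_verts.
      (* In c(id - Sd) = c(dT + Td) the term c(dT) vanishes because c is a cocycle; c(Td) is what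
         remains to telescope. *)
      rewrite -subdiv_htpy_cobd -[LHS]add0r; congr (_ + _); rewrite -[LHS](subdiv_htpy0 K l).
      apply: subdiv_htpy_ext => l' _ hl'.
      rewrite (cobd_ev_cocycle (@stdsimplex_convex n) hs)//.
      apply: hl'; first exact: stdsimplex_convex.
      by apply: hl; [exact: stdsimplex_convex|exact: verts_stdsimplex].
    by rewrite iter_subdivB -iterSr.
  have -> : cobd (h M) (verts n) = \sum_(k < M) F k by exact: cobd_sum.
  rewrite -[c s]ev_verts -/(A 0%N) -/(A M).
  under eq_bigr do rewrite FE.
  elim: M => [|M IH]; first by rewrite big_ord0 subrr.
  by rewrite big_ord_recr /= IH addrA subrK.
have {}tele : \forall M \near \oo, c s = cobd (h M) (verts n).
  apply: filterS (iter_subdiv_small hs) => M HM.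
  by rewrite tele HM ?subr0// => l; apply; exact: hull_sub.
case: n s hs @h tele => [|n] s hs h tele.
  (* In degree 0 the boundary is the empty list, where T vanishes. Hence [c s = 0], in agreement
     with [coboundary] in degree 0. *)
  have [M] := filter_ex tele.
  have -> : verts 0 = [:: \row_k (k == 0 :> nat)%:R] by [].
  rewrite /= subr0 => ->; rewrite /h big1// => k _.
  by elim: (nat_of_ord k) => //= {}k IH; rewrite /subdiv.
(* There are finitely many faces, so one M reaches the limit on all of them; naturality under the
   face maps then identifies their sums with values of [h M]. *)
have H : \forall M \near \oo, forall i : 'I_n.+2,
    homotopy_sum (s \o face_map i) M = homotopy_limit (s \o face_map i).
  by apply: filter_forall => i; apply: homotopy_limitP; apply: singular_face.
have [M [-> HM]] := filter_ex (filterI tele H).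
symmetry; apply: coboundary_verts => i; rewrite -HM.
apply: eq_bigr => k _; rewrite iter_subdiv_map; congr (iter k subdiv _ _).
apply/funext => l; rewrite /= subdiv_htpy_map; congr subdiv_htpy.
by apply/funext => m; rewrite /= ev_map.
Qed.
End Small.

(** * Cup products and cohomologous cocycles *)

Section Cochains.
Context {K : comPzRingType} {X : topologicalType}.
Implicit Types (a b c w : cochain K X).

Lemma coboundaryE c n (s : 'rV[RR]_n.+1 -> X) :
  coboundary c n s = cobd (ev c s) (verts n).
Proof. by rewrite cobd_ev ev_verts. Qed.

Lemma cocycleP c : (forall n (s : 'rV[RR]_n.+1 -> X), singular s ->
  cobd (ev c s) (verts n) = 0) -> is_cocycle c.
Proof. by move=> H n s hs; rewrite coboundaryE; apply: H. Qed.

Lemma ev_sub (V : lmodType RR) a b (s : V -> X) :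
  ev (cochain_sub a b) s = (fun l => ev a s l - ev b s l).
Proof. by apply/funext => -[|v l] /=; rewrite ?subrr. Qed.

Lemma ev_coboundary (V : lmodType RR) c (s : V -> X) :
  ev (coboundary c) s = cobd (ev c s).
Proof. by apply/funext => l; rewrite cobd_ev. Qed.

Lemma ev_cupE (V : lmodType RR) a b (s : V -> X) :
  ev (cup a b) s = cup_seq (ev a s) (ev b s).
Proof. by apply/funext => l; rewrite ev_cup. Qed.

Lemma verts_sub_stdsimplex n (m : seq 'rV[RR]_n.+1) :
  {subset m <= verts n} -> forall v, v \in m -> stdsimplex n v.
Proof. by move=> sub v /sub; apply: verts_stdsimplex. Qed.

Lemma cobd_ev_verts c n (s : 'rV[RR]_n.+1 -> X) m : is_cocycle c -> singular s ->
  {subset m <= verts n} -> cobd (ev c s) m = 0.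
Proof.
move=> cc hs sub; apply: (cobd_ev_cocycle (@stdsimplex_convex n) hs) => //.
exact: verts_sub_stdsimplex.
Qed.

Lemma ev_wd_verts c n (s t : 'rV[RR]_n.+1 -> X) m : cochain_wd c ->
  singular s -> singular t -> {in stdsimplex n, s =1 t} ->
  {subset m <= verts n} -> ev c s m = ev c t m.
Proof.
move=> cwd hs ht st sub; apply: (ev_wd (@stdsimplex_convex n) hs) => //.
  by move=> x dx; apply: st; rewrite inE.
exact: verts_sub_stdsimplex.
Qed.

Lemma sub_wd a b : cochain_wd a -> cochain_wd b -> cochain_wd (cochain_sub a b).
Proof.
move=> aw bw n s t hs ht st; rewrite /cochain_sub.
by rewrite (aw _ _ t)// (bw _ _ t).
Qed.

Lemma sub_cocycle a b : is_cocycle a -> is_cocycle b ->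
  is_cocycle (cochain_sub a b).
Proof.
by move=> ac bc; apply: cocycleP => n s hs; rewrite ev_sub cobdB !cobd_ev_verts ?subrr.
Qed.

Lemma coboundary_wd c : cochain_wd c -> cochain_wd (coboundary c).
Proof.
move=> cw n s t hs ht st; rewrite !coboundaryE; apply: cobd_ext => m sub _.
exact: ev_wd_verts.
Qed.

Lemma coboundary_cocycle c : is_cocycle (coboundary c).
Proof. by apply: cocycleP => n s _; rewrite ev_coboundary cobd_cobd. Qed.

Lemma alt_wd c : cochain_wd c -> cochain_wd (alt c).
Proof. by move=> cw n s t hs ht st; rewrite /alt (cw _ _ t). Qed.

Lemma alt_cocycle c : is_cocycle c -> is_cocycle (alt c).
Proof.
move=> cc; apply: cocycleP => n s hs.
by rewrite ev_alt cobd_altl /altl cobd_ev_verts// mulr0 oppr0.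
Qed.

Lemma cup_wd a b : cochain_wd a -> cochain_wd b -> cochain_wd (cup a b).
Proof.
move=> aw bw n s t hs ht st; rewrite -!ev_verts !ev_cup.
by apply: cup_seq_ext => m sub; apply: ev_wd_verts.
Qed.

Lemma cobd_cup (V : lmodType RR) a b (s : V -> X) l :
  cobd (ev (cup a b) s) l = cup_seq (cobd (ev a s)) (ev b s) l
    - cup_seq (altl (ev a s)) (cobd (ev b s)) l.
Proof. by rewrite ev_cupE cobd_cup_seq// mul0r subr0. Qed.

Lemma cup_cocycle a b : is_cocycle a -> is_cocycle b -> is_cocycle (cup a b).
Proof.
move=> ac bc; apply: cocycleP => n s hs; rewrite cobd_cup.
by rewrite cup_seq0l ?cup_seq0r ?subrr// => m sub; apply: cobd_ev_verts.
Qed.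

Lemma cup_unit_wd : cochain_wd (@cup_unit K X).
Proof. by []. Qed.

Lemma cup_unit_cocycle : is_cocycle (@cup_unit K X).
Proof.
move=> [|[|n]] s _ //=.
  by rewrite !big_ord_recl big_ord0 /= expr0 expr1; ring.
by rewrite big1// => i _; rewrite mulr0.
Qed.

Definition cohomologous a b := exists w, cochain_wd w /\
  forall n (s : 'rV[RR]_n.+1 -> X), singular s -> a n s - b n s = coboundary w n s.

Lemma cohomologous_refl a : cohomologous a a.
Proof.
exists (fun _ _ => 0); split=> // n s _; rewrite subrr.
case: n s => [|n] s //=; by rewrite big1// => i _; rewrite mulr0.
Qed.

(** Write ab - a'b' = (a - a')b + a'(b - b'), with a - a' = du and b - b' = dv. As b and a' are
    cocycles, the first term is d(ub) and the second is -d([alt a'] v), which gives the witness. *)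
Lemma cup_cohomologous a a' b b' : is_cocycle a' -> is_cocycle b ->
  cochain_wd a' -> cochain_wd b ->
  cohomologous a a' -> cohomologous b b' -> cohomologous (cup a b) (cup a' b').
Proof.
move=> ac bc aw bw [u [uw hu]] [v [vw hv]].
exists (cochain_sub (cup u b) (cup (alt a') v)); split.
  by apply: sub_wd; apply: cup_wd => //; apply: alt_wd.
have evB c c' w n (s : 'rV[RR]_n.+1 -> X) m : singular s ->
    (forall k (t : 'rV[RR]_k.+1 -> X), singular t ->
      c k t - c' k t = coboundary w k t) ->
    {subset m <= verts n} -> cobd (ev w s) m = ev c s m - ev c' s m.
  move=> hs H sub; rewrite -ev_coboundary; case E : m => [|x l].
    by rewrite /= subrr.
  have sm : size m = (size l).+1 by rewrite E.
  rewrite -E !(@evE _ _ _ _ _ _ (size l))// H//.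
  by apply: (singular_aff (@stdsimplex_convex n) hs) => //; apply: verts_sub_stdsimplex.
move=> n s hs; rewrite coboundaryE ev_sub cobdB !cobd_cup.
rewrite (@cup_seq0r _ _ (altl (ev u s))) ?subr0; last by move=> m; apply: cobd_ev_verts.
rewrite (@cup_seq0l _ _ (cobd (ev (alt a') s))); last first.
  by move=> m; apply: cobd_ev_verts => //; apply: alt_cocycle.
rewrite (cup_seq_ext (f2 := fun m => ev a s m - ev a' s m) (g2 := ev b s))//; last first.
  by move=> m; apply: evB.
rewrite (cup_seq_ext (f1 := altl (ev (alt a') s)) (f2 := ev a' s)
  (g2 := fun m => ev b s m - ev b' s m)); first last.
- by move=> m; apply: evB.
- by move=> m _; rewrite ev_alt /altl mulrA -expr2 sqrr_sign mul1r.
by rewrite cup_seqBl cup_seqBr sub0r opprK addrA subrK -!ev_cup !ev_verts.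
Qed.

Section CupList.
Variables (J : eqType) (A : J -> cochain K X).
Hypotheses (Aw : forall j, cochain_wd (A j)) (Ac : forall j, is_cocycle (A j)).

Lemma cup_list_wd r : cochain_wd (cup_list [seq A j | j <- r]).
Proof. by elim: r => [|j r IH] /=; [exact: cup_unit_wd|exact: cup_wd]. Qed.

Lemma cup_list_cocycle r : is_cocycle (cup_list [seq A j | j <- r]).
Proof. by elim: r => [|j r IH] /=; [exact: cup_unit_cocycle|exact: cup_cocycle]. Qed.

End CupList.

Lemma cup_list_cohomologous (J : eqType) (A B : J -> cochain K X) r :
  (forall j, cochain_wd (A j)) -> (forall j, is_cocycle (A j)) ->
  (forall j, cochain_wd (B j)) -> (forall j, is_cocycle (B j)) ->
  (forall j, cohomologous (A j) (B j)) ->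
  cohomologous (cup_list [seq A j | j <- r]) (cup_list [seq B j | j <- r]).
Proof.
move=> Aw Ac Bw Bc AB; elim: r => [|j r IH] /=; first exact: cohomologous_refl.
apply: cup_cohomologous => //; [exact: cup_list_cocycle|exact: cup_list_wd].
Qed.

Lemma ev_restrict (U : set X) c n (s : 'rV[RR]_n.+1 -> X) m :
  (forall k (t : 'rV[RR]_k.+1 -> X), singular t ->
     (forall x, stdsimplex k x -> U (t x)) -> c k t = 0) ->
  singular s -> (forall x, stdsimplex n x -> U (s x)) ->
  {subset m <= verts n} -> ev c s m = 0.
Proof.
move=> H hs sU sub; case E : m => [//|v l].
have sm : size m = (size l).+1 by rewrite E.
have dm := verts_sub_stdsimplex sub.
rewrite -E (@evE _ _ _ _ _ _ (size l))//; apply: H.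
  exact: (singular_aff (@stdsimplex_convex n) hs).
by move=> x dx; apply: sU; apply: aff_in dx => //; exact: stdsimplex_convex.
Qed.

(** Front and back faces of a simplex in U stay in U, so the factor j kills every term of the
    product. *)
Lemma cup_list_vanish (J : eqType) (B : J -> cochain K X) (U : set X) r j :
  j \in r ->
  (forall n (s : 'rV[RR]_n.+1 -> X), singular s ->
     (forall x, stdsimplex n x -> U (s x)) -> B j n s = 0) ->
  forall n (s : 'rV[RR]_n.+1 -> X), singular s ->
    (forall x, stdsimplex n x -> U (s x)) ->
    cup_list [seq B j | j <- r] n s = 0.
Proof.
move=> jr H; elim: r jr => //= i r IH; rewrite in_cons => /orP[/eqP ji|jr] n s hs sU;
  rewrite -ev_verts ev_cup.
  by apply: cup_seq0l => m; apply: (ev_restrict (U := U)) => //; rewrite -ji.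
by apply: cup_seq0r => m; apply: (ev_restrict (U := U)) => //; apply: IH.
Qed.

End Cochains.

(** * Homotopies *)

Lemma aff_fst (V W : lmodType RR) m (l : seq (V * W)) (x : 'rV[RR]_m) :
  (aff l x).1 = aff (map fst l) x.
Proof. by rewrite (aff_map fst). Qed.

Lemma aff_snd (V W : lmodType RR) m (l : seq (V * W)) (x : 'rV[RR]_m) :
  (aff l x).2 = aff (map snd l) x.
Proof. by rewrite (aff_map snd). Qed.

Lemma setX_convex (V W : lmodType RR) (C : set V) (D : set W) :
  convex_closed C -> convex_closed D -> convex_closed (C `*` D).
Proof.
move=> cC cD m l x dx Cl; split; rewrite ?aff_fst ?aff_snd.
  apply: cC => // i im; have [] := Cl i im.
  have [il|il] := ltnP i (size l); first by rewrite (nth_map 0).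
  by rewrite !nth_default ?size_map.
apply: cD => // i im; have [] := Cl i im.
have [il|il] := ltnP i (size l); first by rewrite (nth_map 0).
by rewrite !nth_default ?size_map.
Qed.

Lemma itv_convex : convex_closed (`[0, 1]%classic : set RR^o).
Proof.
move=> m l x [x0 x1] Cl; rewrite /= in_itv /=; apply/andP; split.
  apply: sumr_ge0 => i _; apply: mulr_ge0 => //.
  by have := Cl i (ltn_ord i); rewrite /= in_itv /= => /andP[].
rewrite -x1; apply: ler_sum => i _; rewrite -[leRHS]mulr1 ler_wpM2l//.
by have := Cl i (ltn_ord i); rewrite /= in_itv /= => /andP[].
Qed.

Lemma aff_pair (t : RR^o) n (x : 'rV[RR]_n.+1) : stdsimplex n x ->
  aff (map (pair t) (verts n)) x = (t, x).
Proof.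
move=> [_ x1]; rewrite [LHS]surjective_pairing aff_fst aff_snd -!map_comp.
congr pair; last by rewrite -[RHS]aff_verts; congr aff; apply: map_id.
transitivity ((\sum_(i < n.+1) x 0 i) * t); last by rewrite x1 mul1r.
rewrite mulr_suml; apply: eq_bigr => i _.
by rewrite (nth_map 0%N) ?size_iota.
Qed.

(** Packaged as a linear map so that [ev_map] gives the naturality of the prism under face maps. *)
Definition map_snd (V W : lmodType RR) (h : V -> W) (p : RR^o * V) : RR^o * W :=
  (p.1, h p.2).

Lemma map_snd_linear (V W : lmodType RR) (h : {linear V -> W}) :
  linear (map_snd h).
Proof. by move=> a [p1 p2] [q1 q2]; rewrite /map_snd /= linearP. Qed.

HB.instance Definition _ (V W : lmodType RR) (h : {linear V -> W}) :=
  GRing.isLinear.Build RR (RR^o * V)%type (RR^o * W)%type _ (map_snd h)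
    (map_snd_linear h).

Section Pullback.
Context {K : comPzRingType} {X Y : topologicalType}.
Variables (f : X -> Y) (z : cochain K Y).
Hypothesis (hf : continuous f).

Lemma singular_comp n (s : 'rV[RR]_n.+1 -> X) : singular s -> singular (f \o s).
Proof.
move=> hs; apply: (within_comp (B := setT)) hs _ _ => //.
exact: continuous_subspaceT.
Qed.

Lemma pullback_wd : cochain_wd z -> cochain_wd (pullback f z).
Proof.
move=> zw n s t hs ht st; apply: zw; [exact: singular_comp..|].
by move=> x dx; rewrite /= st.
Qed.

Lemma pullback_cocycle : is_cocycle z -> is_cocycle (pullback f z).
Proof.
move=> zc n s hs; rewrite -(zc _ _ (singular_comp hs)).
by case: n s hs.
Qed.
End Pullback.

Section PrismLocal.
Context {K : comPzRingType} {X Y : topologicalType}.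
Variables (f g : X -> Y) (z : cochain K Y) (U : set X).
Hypotheses (hf : continuous f) (hg : continuous g).
Hypotheses (zw : cochain_wd z) (zc : is_cocycle z).
Variable H : RR * X -> Y.
Hypotheses (cH : {within `[0%R, 1%R] `*` U, continuous H})
  (H0 : forall x, U x -> H (0%R, x) = f x)
  (H1 : forall x, U x -> H (1%R, x) = g x).

Let Hs (V : lmodType RR) (s : V -> X) (p : RR^o * V) : Y := H (p.1, s p.2).

Let C n : set (RR^o * 'rV[RR]_n.+1) := `[0, 1]%classic `*` stdsimplex n.

Let cC n : convex_closed (@C n).
Proof. by apply: setX_convex; [exact: itv_convex|exact: stdsimplex_convex]. Qed.

Let inU n (s : 'rV[RR]_n.+1 -> X) := forall x, stdsimplex n x -> U (s x).

Let Hs_continuous n (s : 'rV[RR]_n.+1 -> X) : singular s -> inU s ->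
  {within @C n, continuous (Hs s)}.
Proof.
move=> /subspace_continuousP hs sU.
apply: (within_comp (f := fun p : RR^o * 'rV[RR]_n.+1 => (p.1 : RR, s p.2))) cH _.
  apply/subspace_continuousP => p Cp.
  have cfst : (q.1 : RR) @[q --> within (@C n) (nbhs p)] --> (p.1 : RR).
    by apply: cvg_trans; [apply: cvg_app; exact: cvg_within|exact: cvg_fst].
  have csnd : s q.2 @[q --> within (@C n) (nbhs p)] --> s p.2.
    apply: cvg_comp (hs _ Cp.2) => P HP; rewrite /= nbhs_simpl /within /=.
    have HQ : nbhs p [set q : RR^o * 'rV[RR]_n.+1 | stdsimplex n q.2 -> P q.2].
      exists (setT, [set y | stdsimplex n y -> P y]); first by split=> //; exact: filterT.
      by move=> q [].
    by apply: filterS HQ => q Hq [_ q2]; apply: Hq.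
  exact: cvg_pair cfst csnd.
by move=> p [p1 p2]; split => //; apply: sU.
Qed.

(** Extension by 0 to simplices not contained in U turns the local homotopy into a cochain on all of
    X. The minus sign is there because the prism formula yields g^* - f^*. *)
Let prism_cochain : cochain K X := fun n s =>
  if `[< inU s >] then - prism (0 : RR^o) 1 (ev z (Hs s)) (verts n) else 0.

Let vertC n (m : seq (RR^o * 'rV[RR]_n.+1)) :
  (forall p, p \in m -> (p.1 = 0 \/ p.1 = 1) /\ p.2 \in verts n) ->
  forall p, p \in m -> @C n p.
Proof.
move=> Hm p /Hm[p1 /verts_stdsimplex p2]; split=> //=.
by case: p1 => ->; rewrite in_itv /= lexx ler01.
Qed.

Let prism_cochain_wd : cochain_wd prism_cochain.
Proof.
move=> n s t hs ht st; rewrite /prism_cochain.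
have st' x : stdsimplex n x -> s x = t x by move=> dx; apply: st; rewrite inE.
have -> : `[< inU s >] = `[< inU t >].
  by apply: asbool_equiv_eq; split=> sU x dx; [rewrite -st'|rewrite st'] => //; apply: sU.
case: asboolP => // tU; congr (- _); apply: prism_ext => m /vertC Cm.
have sU : inU s by move=> x dx; rewrite st'//; apply: tU.
apply: (ev_wd (@cC n)) => //; try exact: Hs_continuous.
by move=> p [_ p2]; rewrite /Hs st'.
Qed.

Let prism_cochainE n (s : 'rV[RR]_n.+1 -> X) : singular s -> inU s ->
  coboundary prism_cochain n s = pullback f z n s - pullback g z n s.
Proof.
move=> hs sU; pose phi := ev z (Hs s).
have ends (t : RR^o) h : t = 0 \/ t = 1 -> continuous h ->
    (forall x, U x -> H (t, x) = h x) ->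
    phi (map (pair t) (verts n)) = pullback h z n s.
  move=> t01 ch Hh; rewrite /phi (@evE _ _ _ _ _ _ n) ?size_map ?size_iota//.
  apply: zw.
  - apply: (singular_aff (@cC n)); first exact: Hs_continuous.
      by rewrite size_map size_verts.
    by apply: vertC => p /mapP[v vl ->].
  - exact: singular_comp.
  - by move=> x; rewrite inE => dx; rewrite /= aff_pair// /Hs Hh//; apply: sU.
(* The other term of the prism formula, [prism (cobd phi)], vanishes since z is a cocycle. *)
have Pphi : cobd (prism (0 : RR^o) 1 phi) (verts n) =
    pullback g z n s - pullback f z n s.
  rewrite -(ends 0 f (or_introl erefl) hf H0) -(ends 1 g (or_intror erefl) hg H1).
  rewrite -prism_cobd -[LHS]add0r; congr (_ + _); symmetry.
  rewrite -[RHS](@prism0 K _ _ (0 : RR^o) 1 (verts n)).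
  apply: prism_ext => m /vertC Cm.
  by apply: (cobd_ev_cocycle (@cC n)) => //; apply: Hs_continuous.
rewrite -opprB -Pphi -cobdN {Pphi ends}.
case: n s hs sU @phi => [|n] s hs sU phi; first by rewrite /= subr0 oppr0.
(* Faces of a simplex in U lie in U, so none of them falls under the extension by 0. *)
apply: coboundary_verts => i; rewrite /prism_cochain asboolT; last first.
  by move=> x dx; apply: sU; apply: face_stdsimplex.
rewrite [in RHS]prism_map; congr (- _); apply: prism_ext => m _.
exact: esym (ev_map (map_snd (face_map i)) z (Hs s) m).
Qed.

(** Subtracting the coboundary of the extended prism cochain gives b. This replaces a lift of the
    class to the cohomology of the pair (X, U). *)
Lemma local_homotopy : exists b : cochain K X,
  [/\ cochain_wd b, is_cocycle b,
    cohomologous (cochain_sub (pullback f z) (pullback g z)) b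
    & forall n (s : 'rV[RR]_n.+1 -> X), singular s ->
        (forall x, stdsimplex n x -> U (s x)) -> b n s = 0].
Proof.
set a := cochain_sub _ _.
have aw : cochain_wd a by apply: sub_wd; apply: pullback_wd.
have ac : is_cocycle a by apply: sub_cocycle; apply: pullback_cocycle.
exists (cochain_sub a (coboundary prism_cochain)); split.
- by apply: sub_wd => //; apply: coboundary_wd.
- by apply: sub_cocycle => //; exact: coboundary_cocycle.
- exists prism_cochain; split=> // n s hs.
  by rewrite /cochain_sub opprB addrCA subrr addr0.
- by move=> n s hs sU; rewrite /cochain_sub prism_cochainE// subrr.
Qed.
End PrismLocal.

(** * Assembling the local representatives *)

Theorem theorem5p2 (K : comPzRingType) (X Y : topologicalType) (f g : X -> Y)
  (hf : continuous f) (hg : continuous g) (n : nat) :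
  hdist_le f g n -> lcp_image_le K f g n.
Proof.
move=> [U [Uo Ucov Uh]] z hz.
pose A i := cochain_sub (pullback f (z i)) (pullback g (z i)).
have /choice[B HB] : forall i, exists b : cochain K X,
    [/\ cochain_wd b, is_cocycle b, cohomologous (A i) b
      & forall k (s : 'rV[RR]_k.+1 -> X), singular s ->
          (forall x, stdsimplex k x -> U i (s x)) -> b k s = 0].
  move=> i; have [zw _ zc] := hz i; have [H [cH H0 H1]] := Uh i.
  exact: local_homotopy cH H0 H1.
have Bw i : cochain_wd (B i) by have [] := HB i.
have Bc i : is_cocycle (B i) by have [] := HB i.
have Aw i : cochain_wd (A i).
  by have [zw _ _] := hz i; apply: sub_wd; apply: pullback_wd.
have Ac i : is_cocycle (A i).
  by have [_ _ zc] := hz i; apply: sub_cocycle; apply: pullback_cocycle.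
have [v [vw hv]] : is_coboundary (cup_list [seq B i | i <- enum 'I_n.+1]).
  apply: (small_coboundary Uo).
  - move=> x; have [j _ Ujx] : (\bigcup_j U j) x by rewrite Ucov.
    by exists j.
  - exact: cup_list_wd.
  - exact: cup_list_cocycle.
  (* Every j occurs in the enumeration of ['I_n.+1], so the product contains the factor [B j], which
     vanishes on simplices in [U j]. *)
  - move=> k s hs [j sU]; have [_ _ _ Bj] := HB j.
    by apply: (cup_list_vanish (U := U j) (j := j)) => //; rewrite mem_enum.
have [w [ww hw]] : cohomologous (cup_list [seq A i | i <- enum 'I_n.+1])
    (cup_list [seq B i | i <- enum 'I_n.+1]).
  by apply: cup_list_cohomologous => // i; have [] := HB i.
(* w bounds the difference of the two products and v bounds the product of the [B i]. *)
exists (fun k s => w k s + v k s); split=> [k s t hs ht st|k s hs].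
  by rewrite (ww _ _ t)// (vw _ _ t).
rewrite -[LHS](subrK (cup_list [seq B i | i <- enum 'I_n.+1] k s)) hw// hv//.
case: k s hs => [|k] s hs /=; first by rewrite addr0.
by rewrite -big_split; apply: eq_bigr => i _; rewrite mulrDr.
Qed.
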